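(* Let $\mathcal{B}$ be an asymptotic gauge on a set of indices $\mathbb{I}$. Then $\mathcal{G}(e^{\mathcal{B}},\mathbb{R})$ is the smallest Colombeau algebra (with respect to the order relation $\preceq$) in which every linear homogeneous ODE with coefficients in $\mathbb{R}_M(\mathcal{B})$ can be solved. That is: (1) every linear homogeneous ODE with coefficients in $\mathbb{R}_M(\mathcal{B})$ can be solved in $\mathcal{G}(e^{\mathcal{B}},\mathbb{R})=\mathcal{G}(e^{\mathcal{B}},e^{\mathcal{B}},\mathbb{R})$; and (2) if $\mathcal{G}(\mathcal{B}',\mathcal{Z}',\mathbb{R})$ is any Colombeau algebra (with $\mathcal{B}'$, $\mathcal{Z}'$ possibly different asymptotic gauges on $\mathbb{I}$) in which every linear homogeneous ODE with coefficients in $\mathbb{R}_M(\mathcal{B})$ can be solved, then $\mathcal{G}(e^{\mathcal{B}},\mathbb{R})\preceq\mathcal{G}(\mathcal{B}',\mathcal{Z}',\mathbb{R})$.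
   Context: $\mathbb{N}$ includes $0$. A set of indices is a triple $\mathbb{I}=(I,\le,\mathcal{I})$ such that: (a) $I$ is a nonempty set and $\le$ is a reflexive and transitive relation on $I$; (b) $\mathcal{I}$ is a set of subsets of $I$ with $\emptyset\notin\mathcal{I}$ and $I\in\mathcal{I}$; (c) for all $A,B\in\mathcal{I}$ there is $C\in\mathcal{I}$ with $C\subseteq A\cap B$; (d) writing $(\emptyset,e]:=\{\varepsilon\in I\mid\varepsilon\le e\}$, $A_{\le e}:=(\emptyset,e]\cap A$, and $\varepsilon<e$ for ''$\varepsilon\le e$ and $\varepsilon\ne e$'': whenever $e\le a\in A\in\mathcal{I}$, the set $A_{\le e}$ is nonempty and for all $b,c\in A_{\le e}$ there is $d\in A_{\le e}$ with $d<b$ and $d<c$. A net is a map $x:I\to\mathbb{R}$, written $(x_\varepsilon)$. Big-O: for $a\in A\in\mathcal{I}$, $x_\varepsilon=O_{a,A}(y_\varepsilon)$ means $\exists H\in\mathbb{R}_{>0}\,\exists\varepsilon_0\in A_{\le a}\,\forall\varepsilon\in A_{\le\varepsilon_0}:|x_\varepsilon|\le H|y_\varepsilon|$; and $x_\varepsilon=O(y_\varepsilon)$ means $\exists A\in\mathcal{I}\,\forall a\in A: x_\varepsilon=O_{a,A}(y_\varepsilon)$. For a property $\mathcal{P}$, $\forall^{\mathbb{I}}\varepsilon:\mathcal{P}(\varepsilon)$ means $\exists A\in\mathcal{I}\,\forall a\in A\,\exists e\le a\,\forall\varepsilon\in A_{\le e}:\mathcal{P}(\varepsilon)$. For nets,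 $i>_{\mathbb{I}}j$ means $\forall^{\mathbb{I}}\varepsilon: i_\varepsilon>j_\varepsilon$. $\lim_{\mathbb{I}}f=\infty$ means $\exists A\in\mathcal{I}\,\forall a\in A\,\forall r>0\,\exists a_0\le a\,\forall\varepsilon\in A_{\le a_0}:|f_\varepsilon|>r$. An asymptotic gauge (AG) on $\mathbb{I}$ is a set $\mathcal{B}\subseteq\mathbb{R}^I$ such that: $\exists i\in\mathcal{B}:\lim_{\mathbb{I}}i=\infty$; $\forall i,j\in\mathcal{B}\,\exists p\in\mathcal{B}: i\cdot j=O(p)$; $\forall i\in\mathcal{B}\,\forall r\in\mathbb{R}\,\exists\sigma\in\mathcal{B}: r\cdot i=O(\sigma)$; $\forall i,j\in\mathcal{B}\,\exists s\in\mathcal{B}: s>_{\mathbb{I}}0$ and $|i|+|j|=O(s)$. Put $\mathcal{B}_{>0}:=\{i\in\mathcal{B}\mid i>_{\mathbb{I}}0\}$, $\mathbb{R}_M(\mathcal{B}):=\{x\in\mathbb{R}^I\mid\exists b\in\mathcal{B}: x_\varepsilon=O(b_\varepsilon)\}$, and $e^{\mathcal{B}}:=\{(e^{H b_\varepsilon})\mid H\in\mathbb{R}_{>0},\,b\in\mathcal{B}\}$, which is again an AG. For $\Omega\subseteq\mathbb{R}^n$ open and AGs $\mathcal{B},\mathcal{Z}$ on $\mathbb{I}$: $\mathcal{E}_M(\mathcal{B},\Omega)$ is the set of $u=(u_\varepsilon)\in\mathcal{C}^\infty(\Omega)^I$ such that for all compact $K\subseteq\Omega$ and $\alpha\in\mathbb{N}^n$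 there is $b\in\mathcal{B}$ with $\sup_{x\in K}|\partial^\alpha u_\varepsilon(x)|=O(b_\varepsilon)$; $\mathcal{N}(\mathcal{Z},\Omega)$ is the set of $u\in\mathcal{C}^\infty(\Omega)^I$ such that for all compact $K\subseteq\Omega$, $\alpha\in\mathbb{N}^n$ and all $z\in\mathcal{Z}_{>0}$, $\sup_{x\in K}|\partial^\alpha u_\varepsilon(x)|=O(z_\varepsilon^{-1})$ (only those sufficiently small $\varepsilon$ with $z_\varepsilon>0$ are considered). If $\mathbb{R}_M(\mathcal{B})\subseteq\mathbb{R}_M(\mathcal{Z})$, the quotient $\mathcal{G}(\mathcal{B},\mathcal{Z},\Omega):=\mathcal{E}_M(\mathcal{B},\Omega)/\mathcal{N}(\mathcal{Z},\Omega)$, with operations and derivatives defined on representatives, is an algebra; ''Colombeau algebra'' here means any such $\mathcal{G}(\mathcal{B},\mathcal{Z},\Omega)$ with $\mathcal{B},\mathcal{Z}$ AGs on $\mathbb{I}$ and $\mathbb{R}_M(\mathcal{B})\subseteq\mathbb{R}_M(\mathcal{Z})$. Put $\mathcal{G}(\mathcal{B},\Omega):=\mathcal{G}(\mathcal{B},\mathcal{B},\Omega)$. Order: for AGs $\mathcal{B},\mathcal{Z},\mathcal{B}',\mathcal{Z}'$ on $\mathbb{I}$, $\mathcal{G}(\mathcal{B},\mathcal{Z},\Omega)\preceq\mathcal{G}(\mathcal{B}',\mathcal{Z}',\Omega)$ means $\mathbb{R}_M(\mathcal{B})\subseteq\mathbb{R}_M(\mathcal{Z})$, $\mathbb{R}_M(\mathcal{B}')\subseteq\mathbb{R}_M(\mathcal{Z}')$,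 $\mathbb{R}_M(\mathcal{B})\subseteq\mathbb{R}_M(\mathcal{B}')$ and $\mathbb{R}_M(\mathcal{Z})\subseteq\mathbb{R}_M(\mathcal{Z}')$. A linear homogeneous ODE with coefficients in $\mathbb{R}_M(\mathcal{B})$ is a Cauchy problem $x'(t)+A\cdot x(t)=0$, $x(t_0)=c$, where $d\in\mathbb{N}_{>0}$, $t_0\in\mathbb{R}$, and $A=(A_\varepsilon)$ (a $d\times d$ matrix) and $c=(c_\varepsilon)$ (a vector of length $d$) have entries in $\mathbb{R}_M(\mathcal{B})$. That all such problems can be solved in a Colombeau algebra $\mathcal{G}(\mathcal{B}',\mathcal{Z}',\mathbb{R})$ means that $\mathbb{R}_M(\mathcal{B})\subseteq\mathbb{R}_M(\mathcal{B}')$ (so that the coefficients define constant generalized functions in $\mathcal{G}(\mathcal{B}',\mathcal{Z}',\mathbb{R})$) and that for each of them there is $x=[x_\varepsilon]\in\mathcal{G}(\mathcal{B}',\mathcal{Z}',\mathbb{R})^d$ with $x'+[A_\varepsilon]x=0$ in $\mathcal{G}(\mathcal{B}',\mathcal{Z}',\mathbb{R})^d$ and $x_\varepsilon(t_0)-c_\varepsilon=O(z_\varepsilon^{-1})$ (componentwise) for all $z\in\mathcal{Z}'_{>0}$. *)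

(* Defs.v *)
From HB Require Import structures.
From mathcomp Require Import all_boot all_order all_algebra.
From mathcomp Require Import generic_quotient ring_quotient.
From mathcomp Require Import all_classical all_reals all_analysis.
From mathcomp Require Import lra.

Set Implicit Arguments.
Unset Strict Implicit.
Unset Printing Implicit Defensive.

Import Order.TTheory GRing.Theory Num.Theory.
Import numFieldNormedType.Exports.

Local Open Scope ring_scope.
Local Open Scope classical_set_scope.

Definition below (I : Type) (le : I -> I -> Prop) (A : set I) (e : I) : set I :=
  [set x | le x e] `&` A.

(* Here d < e means d <= e and d <> e, although <= need not be antisymmetric. *)
Record is_index_set (I : Type) (le : I -> I -> Prop) (F : set (set I)) : Prop :=
  IsIndexSet {
    is_index_set_nonempty : [set: I] !=set0 ;
    is_index_set_refl : forall e, le e e ;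
    is_index_set_trans : forall d e f, le d e -> le e f -> le d f ;
    is_index_set_set0 : ~ F set0 ;
    is_index_set_setT : F setT ;
    is_index_set_cap : forall A B, F A -> F B -> exists2 C, F C & C `<=` A `&` B ;
    is_index_set_below : forall A a e, F A -> A a -> le e a ->
      below le A e !=set0 /\
      forall b c, below le A e b -> below le A e c ->
        exists2 d, below le A e d & (le d b /\ d <> b) /\ (le d c /\ d <> c)
  }.

Record index_set := IndexSet {
  idx :> Type ;
  ile : idx -> idx -> Prop ;
  ifam : set (set idx) ;
  index_setP : is_index_set ile ifam
}.

Section nets.
Variables (R : realType) (I : index_set).
Implicit Types (A : set I) (x y z i j : I -> R) (P : I -> Prop).

Definition belowI A (e : I) : set I := below (@ile I) A e.

Definition bigO_in (a : I) A x y : Prop :=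
  exists2 H : R, 0 < H & exists2 e0, belowI A a e0 &
    forall e, belowI A e0 e -> `|x e| <= H * `|y e|.

Definition bigO_net x y : Prop :=
  exists2 A, ifam A & forall a, A a -> bigO_in a A x y.

Definition for_small P : Prop :=
  exists2 A, ifam A & forall a, A a ->
    exists2 e0, ile e0 a & forall e, belowI A e0 e -> P e.

Definition pos_net z : Prop := for_small (fun e => 0 < z e).

Definition lim_infty x : Prop :=
  exists2 A, ifam A & forall a, A a -> forall r : R, 0 < r ->
    exists2 a0, ile a0 a & forall e, belowI A a0 e -> r < `|x e|.

Record is_gauge (B : set (I -> R)) : Prop := IsGauge {
  is_gauge_infty : exists2 i, B i & lim_infty i ;
  is_gauge_mul : forall i j, B i -> B j ->
    exists2 p, B p & bigO_net (fun e => i e * j e) p ;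
  is_gauge_scale : forall i (r : R), B i ->
    exists2 s, B s & bigO_net (fun e => r * i e) s ;
  is_gauge_add : forall i j, B i -> B j ->
    exists2 s, B s & pos_net s /\ bigO_net (fun e => `|i e| + `|j e|) s
}.

Record gauge := Gauge {
  gset : set (I -> R) ;
  gaugeP : is_gauge gset
}.

Definition gauge_pos (B : gauge) : set (I -> R) := [set z | gset B z /\ pos_net z].

Definition RM (B : gauge) : set (I -> R) := [set x | exists2 b, gset B b & bigO_net x b].

(* Where z is not positive, z^-1 is irrelevant: see bigO_inv_pos below. *)
Definition negl_net (Z : gauge) x : Prop :=
  forall z, gauge_pos Z z -> bigO_net x (fun e => (z e)^-1).

Definition exp_set (B : set (I -> R)) : set (I -> R) :=
  [set x | exists2 H : R, 0 < H & exists2 b, B b & x = fun e => expR (H * b e)].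

(* Common generalization of bigO_net and for_small: P may depend on a constant H
   that is allowed to vary with a. *)
Definition evH (P : R -> I -> Prop) : Prop :=
  exists2 A, ifam A & forall a, A a -> exists2 H : R, 0 < H &
    exists2 e0, belowI A a e0 & forall e, belowI A e0 e -> P H e.

Lemma below_ne A a e : ifam A -> A a -> ile e a -> exists e', belowI A e e'.
Proof. by move=> FA Aa ea; have [] := is_index_set_below (index_setP I) FA Aa ea. Qed.

Lemma ile_trans (d e f : I) : ile d e -> ile e f -> ile d f.
Proof. exact: (is_index_set_trans (index_setP I)). Qed.

Lemma small_evH P : for_small P -> evH (fun _ e => P e).
Proof.
move=> [A FA hA]; exists A => // a Aa; exists 1 => //.
have [e0 e0a h] := hA a Aa.
have [e1 [e10 Ae1]] := below_ne FA Aa e0a.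
exists e1; first by split=> //; exact: ile_trans e10 e0a.
by move=> e [ee1 Ae]; apply: h; split=> //; exact: ile_trans ee1 e10.
Qed.

Lemma evH_small (P : R -> I -> Prop) Q :
  (forall H e, 0 < H -> P H e -> Q e) -> evH P -> for_small Q.
Proof.
move=> PQ [A FA hA]; exists A => // a Aa.
have [H H0 [e0 [e0a _] h]] := hA a Aa.
by exists e0 => // e Ae; apply: (PQ H) => //; exact: h.
Qed.

Lemma evH2 (P Q S : R -> I -> Prop) :
  (forall H1 H2, 0 < H1 -> 0 < H2 -> exists2 H, 0 < H &
    forall e, P H1 e -> Q H2 e -> S H e) -> evH P -> evH Q -> evH S.
Proof.
move=> comb [A1 F1 h1] [A2 F2 h2].
have [C FC CA] := is_index_set_cap (index_setP I) F1 F2.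
exists C => // a Ca.
have [H1 H10 [e1 [e1a _] k1]] := h1 a (CA _ Ca).1.
have [c1 [c1e1 Cc1]] := below_ne FC Ca e1a.
have [H2 H20 [e2 [e2c _] k2]] := h2 c1 (CA _ Cc1).2.
have [c2 [c2e2 Cc2]] := below_ne FC Cc1 e2c.
have [H H0 hH] := comb _ _ H10 H20.
have c2c1 : ile c2 c1 by exact: ile_trans c2e2 e2c.
exists H => //; exists c2.
  by split=> //; apply: ile_trans e1a; apply: ile_trans c1e1.
move=> e [ec2 Ce]; apply: hH.
- apply: k1; split; last exact: (CA _ Ce).1.
  by apply: ile_trans ec2 _; exact: ile_trans c2c1 c1e1.
- apply: k2; split; last exact: (CA _ Ce).2.
  exact: ile_trans ec2 c2e2.
Qed.

Lemma evH_lim (P S : R -> I -> Prop) x :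
  (forall H1, 0 < H1 -> exists2 r, 0 < r & exists2 H, 0 < H &
    forall e, P H1 e -> r < `|x e| -> S H e) -> evH P -> lim_infty x -> evH S.
Proof.
move=> comb [A1 F1 h1] [A2 F2 h2].
have [C FC CA] := is_index_set_cap (index_setP I) F1 F2.
exists C => // a Ca.
have [H1 H10 [e1 [e1a _] k1]] := h1 a (CA _ Ca).1.
have [c1 [c1e1 Cc1]] := below_ne FC Ca e1a.
have [r r0 [H H0 hH]] := comb _ H10.
have [e2 e2c k2] := h2 c1 (CA _ Cc1).2 r r0.
have [c2 [c2e2 Cc2]] := below_ne FC Cc1 e2c.
have c2c1 : ile c2 c1 by exact: ile_trans c2e2 e2c.
exists H => //; exists c2.
  by split=> //; apply: ile_trans e1a; apply: ile_trans c1e1.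
move=> e [ec2 Ce]; apply: hH.
- apply: k1; split; last exact: (CA _ Ce).1.
  by apply: ile_trans ec2 _; exact: ile_trans c2c1 c1e1.
- apply: k2; split; last exact: (CA _ Ce).2.
  exact: ile_trans ec2 c2e2.
Qed.

Lemma evHT : evH (fun _ _ => True).
Proof.
exists setT; first exact: (is_index_set_setT (index_setP I)).
move=> a _; exists 1 => //; exists a => //; split=> //.
exact: (is_index_set_refl (index_setP I)).
Qed.

Lemma evH1 (P S : R -> I -> Prop) :
  (forall H1, 0 < H1 -> exists2 H, 0 < H &
    forall e, P H1 e -> S H e) -> evH P -> evH S.
Proof.
move=> comb hP; apply: (evH2 _ hP evHT) => H1 H2 H10 _.
by have [H H0 h] := comb _ H10; exists H => // e /h.
Qed.

Lemma evH_not_False (P : R -> I -> Prop) : (forall H e, 0 < H -> ~ P H e) -> ~ evH P.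
Proof.
move=> nP [A FA hA].
have [A0|/nonemptyPn A0] := pselect (A !=set0); last first.
  by apply: (is_index_set_set0 (index_setP I)); rewrite -A0.
have [a Aa] := A0; have [H H0 [e0 e0a h]] := hA a Aa.
have [e Ae] := below_ne FA e0a.2 (is_index_set_refl (index_setP I) e0).
exact: (nP H e H0 (h e Ae)).
Qed.

End nets.

Section gauge_theory.
Variables (R : realType) (I : index_set).
Implicit Types (x y z i j : I -> R) (P : I -> Prop) (B Z : gauge R I).

Lemma normDn (a b : R) : `| `|a| + `|b| | = `|a| + `|b|.
Proof. by rewrite ger0_norm ?addr_ge0. Qed.

Lemma lim_infty_dom x y (P : R -> I -> Prop) :
  (forall H r, 0 < H -> 0 < r -> exists2 r', 0 < r' &
     forall e, P H e -> r' < `|x e| -> r < `|y e|) ->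
  evH P -> lim_infty x -> lim_infty y.
Proof.
move=> comb [A1 F1 h1] [A2 F2 h2].
have [C FC CA] := is_index_set_cap (index_setP I) F1 F2.
exists C => // a Ca r r0.
have [H1 H10 [e1 [e1a _] k1]] := h1 a (CA _ Ca).1.
have [c1 [c1e1 Cc1]] := below_ne FC Ca e1a.
have [r' r'0 hr'] := comb _ _ H10 r0.
have [e2 e2c k2] := h2 c1 (CA _ Cc1).2 r' r'0.
exists e2; first by apply: ile_trans e2c (ile_trans c1e1 e1a).
move=> e [ee2 Ce]; apply: hr'.
- apply: k1; split; last exact: (CA _ Ce).1.
  exact: ile_trans ee2 (ile_trans e2c c1e1).
- by apply: k2; split => //; exact: (CA _ Ce).2.
Qed.

Lemma bigO_trans x y z : bigO_net x y -> bigO_net y z -> bigO_net x z.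
Proof.
apply: evH2 => H1 H2 H10 H20; exists (H1 * H2); first exact: mulr_gt0.
move=> e h1 h2; apply: (le_trans h1); rewrite -mulrA.
by rewrite ler_pM2l.
Qed.

Lemma bigO_le x y (H : R) : (forall e, `|x e| <= H * `|y e|) -> bigO_net x y.
Proof.
move=> h; apply: evH1 (@evHT R I) => _ _; exists (`|H| + 1); first by rewrite ltr_wpDl.
move=> e _; apply: (le_trans (h e)); apply: ler_wpM2r => //.
by rewrite (le_trans (ler_norm _))// lerDl.
Qed.

Lemma gauge_absorb B b : gset B b -> exists2 p, gauge_pos B p &
  forall P : R -> I -> Prop, evH P -> for_small (fun e => exists2 H,
    0 < H & P H e /\ H * `|b e| <= p e /\ 0 < p e).
Proof.
move=> Bb; have [i Bi li] := is_gauge_infty (gaugeP B).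
have [q1 Bq1 O1] := is_gauge_mul (gaugeP B) Bb Bi.
have [q2 Bq2 O2] := is_gauge_mul (gaugeP B) Bq1 Bi.
have [p Bp [pp O3]] := is_gauge_add (gaugeP B) Bq2 Bq2.
exists p => // P evP.
have step1 : evH (fun K e => `|b e| * `|i e| ^+ 2 <= K * p e).
  have h12 : evH (fun K e => `|b e| * `|i e| ^+ 2 <= K * `|q2 e|).
    apply: evH2 O1 O2 => K1 K2 K10 K20; exists (K1 * K2); first exact: mulr_gt0.
    move=> e; rewrite !normrM => h1 h2.
    rewrite expr2 mulrA; apply: le_trans (_ : K1 * (`|q1 e| * `|i e|) <= _).
      by rewrite mulrA ler_wpM2r.
    by rewrite -mulrA ler_pM2l.
  have h123 : evH (fun K e => `|b e| * `|i e| ^+ 2 <= K * `|p e|).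
    apply: evH2 h12 O3 => K1 K2 K10 K20; exists (K1 * K2); first exact: mulr_gt0.
    move=> e h1 h2; apply: (le_trans h1); rewrite -mulrA ler_pM2l//.
    apply: le_trans h2; rewrite normDn.
    by rewrite lerDl.
  apply: evH2 h123 (small_evH R pp) => K1 K2 K10 K20; exists K1 => // e + pe.
  by rewrite (gtr0_norm pe).
have step2 : evH (fun K e => exists2 H, 0 < H &
    [/\ P H e, H * `|b e| * `|i e| ^+ 2 <= K * p e & 0 < p e]).
  have evPp : evH (fun K e => P K e /\ 0 < p e).
    by apply: evH2 evP (small_evH R pp) => K1 K2 K10 K20; exists K1.
  apply: evH2 evPp step1 => H K H0 K0; exists (H * K); first exact: mulr_gt0.
  move=> e [PHe pe] h; exists H => //; split => //.
  by rewrite -!mulrA ler_pM2l.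
apply: (@evH_small R I (fun _ e => exists2 H,
    0 < H & P H e /\ H * `|b e| <= p e /\ 0 < p e)) => //.
apply: evH_lim step2 li => K K0; exists (K + 1); first exact: addr_gt0.
exists 1 => // e [H H0 [PHe h pe]] ie; exists H => //; split=> //; split=> //.
have i1 : 1 < `|i e| by apply: lt_trans ie; rewrite ltrDr.
have iK : K < `|i e| ^+ 2.
  rewrite expr2; apply: (@lt_trans _ _ `|i e|); last by rewrite ltr_pMr// (lt_trans ltr01).
  by apply: lt_trans ie; rewrite ltrDl.
have i20 : 0 < `|i e| ^+ 2 by exact: lt_trans iK.
rewrite -(ler_pM2r i20); apply: (le_trans h).
by rewrite mulrC ler_pM2l// ltW.
Qed.

Lemma expR_le_gauge B b b' (H H' : R) : gset B b -> gset B b' -> 0 < H -> 0 < H' ->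
  exists2 p, gset B p & for_small (fun e => H * b e + H' * b' e <= (H + H') * p e).
Proof.
move=> Bb Bb' H0 H'0.
have [s Bs [ps Os]] := is_gauge_add (gaugeP B) Bb Bb'.
have [p [Bp _] hp] := gauge_absorb Bs.
exists p => //; apply: evH_small (small_evH R (hp _ Os)) => _ e _ [K K0 [h1 [h2 pe]]].
have {}h1 : `|b e| + `|b' e| <= p e.
  by apply: le_trans h2; apply: le_trans h1; rewrite normDn.
have := ler_norm (b e); have := ler_norm (b' e).
have := normr_ge0 (b e); have := normr_ge0 (b' e).
set nb := `|b e| in h1 *; set nb' := `|b' e| in h1 *.
move=> nb'0 nb0 lb' lb.
rewrite mulrDl lerD// ler_pM2l//; lra.
Qed.

Lemma exp_gauge_subproof B : is_gauge (exp_set (gset B)).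
Proof.
split.
- have [i Bi li] := is_gauge_infty (gaugeP B).
  have [p Bp [pp Op]] := is_gauge_add (gaugeP B) Bi Bi.
  exists (fun e => expR (1 * p e)); first by exists 1 => //; exists p.
  have ev : evH (fun K e => `|i e| <= K * p e /\ 0 < p e).
    apply: evH2 Op (small_evH R pp) => K1 K2 K10 K20; exists K1 => // e.
    rewrite normDn => + pe; rewrite (gtr0_norm pe) => h.
    by split=> //; apply: le_trans h; rewrite lerDl.
  apply: lim_infty_dom ev li => H r H0 r0.
  exists (H * r); first exact: mulr_gt0.
  move=> e [h pe] hr; rewrite mul1r (gtr0_norm (expR_gt0 _)).
  have : r < p e by rewrite -(ltr_pM2l H0); exact: lt_le_trans hr h.
  move/lt_le_trans; apply; apply: le_trans (expR_ge1Dx _); by rewrite lerDr.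
- move=> _ _ [H H0 [b Bb ->]] [H' H'0 [b' Bb' ->]].
  have [p Bp hp] := expR_le_gauge Bb Bb' H0 H'0.
  exists (fun e => expR ((H + H') * p e)).
    by exists (H + H'); [exact: addr_gt0|exists p].
  apply: evH1 (small_evH R hp) => _ _; exists 1 => // e h.
  by rewrite -expRD !(gtr0_norm (expR_gt0 _)) mul1r ler_expR.
- move=> _ r [H H0 [b Bb ->]]; exists (fun e => expR (H * b e)).
    by exists H => //; exists b.
  by apply: (@bigO_le _ _ `|r|) => e; rewrite normrM.
- move=> _ _ [H H0 [b Bb ->]] [H' H'0 [b' Bb' ->]].
  have [s Bs [ps Os]] := is_gauge_add (gaugeP B) Bb Bb'.
  have [p [Bp _] hp] := gauge_absorb Bs.
  exists (fun e => expR ((H + H') * p e)).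
    by exists (H + H'); [exact: addr_gt0|exists p].
  split.
    by apply: evH_small (@evHT R I) => *; exact: expR_gt0.
  apply: evH1 (small_evH R (hp _ Os)) => _ _; exists 2 => // e [K K0 [h1 [h2 pe]]].
  have {}h1 : `|b e| + `|b' e| <= p e.
    by apply: le_trans h2; apply: le_trans h1; rewrite normDn.
  have lb : b e <= p e.
    by apply: le_trans h1; rewrite (le_trans (ler_norm _))// lerDl.
  have lb' : b' e <= p e.
    by apply: le_trans h1; rewrite (le_trans (ler_norm _))// lerDr.
  rewrite normDn !(gtr0_norm (expR_gt0 _)).
  rewrite mulr_natl mulr2n; apply: lerD; rewrite ler_expR.
    by rewrite mulrDl ler_wpDr ?ler_pM2l// mulr_ge0 ?ltW.
  by rewrite mulrDl ler_wpDl ?ler_pM2l// mulr_ge0 ?ltW.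
Qed.

Definition exp_gauge B : gauge R I := Gauge (exp_gauge_subproof B).

Lemma bigO_inv_pos x z : pos_net z ->
  bigO_net x (fun e => (z e)^-1) <->
  exists2 A, ifam A & forall a, A a -> exists2 H : R, 0 < H &
    exists2 e0, belowI A a e0 & forall e, belowI A e0 e ->
      0 < z e /\ `|x e| <= H / z e.
Proof.
move=> pz; split.
- move=> O; apply: evH2 O (small_evH R pz) => H1 H2 H10 H20.
  by exists H1 => // e h ze; split=> //; rewrite normfV (gtr0_norm ze) in h.
- apply: evH1 => H H0; exists H => // e [ze].
  by rewrite normfV (gtr0_norm ze).
Qed.

Lemma RM_le B x y : (forall e, `|x e| <= `|y e|) -> RM B y -> RM B x.
Proof.
move=> h [b Bb O]; exists b => //; apply: bigO_trans O.
by apply: (@bigO_le _ _ 1) => e; rewrite mul1r.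
Qed.

Lemma RM_cst B (r : R) : RM B (fun=> r).
Proof.
have [i Bi li] := is_gauge_infty (gaugeP B); exists i => //.
apply: evH_lim (@evHT R I) li => _ _; exists 1 => //.
exists (`|r| + 1); first by rewrite ltr_wpDl.
move=> e _ ie; apply: (@le_trans _ _ (`|r| + 1)); first by rewrite lerDl.
by rewrite ler_pMr ?ltW// ltr_wpDl.
Qed.

Lemma RM_D B x y : RM B x -> RM B y -> RM B (fun e => x e + y e).
Proof.
move=> [b Bb Ob] [c Bc Oc].
have [s Bs [_ Os]] := is_gauge_add (gaugeP B) Bb Bc.
exists s => //; apply: bigO_trans Os.
apply: evH2 Ob Oc => H K H0 K0; exists (H + K); first exact: addr_gt0.
move=> e h k; apply: (le_trans (ler_normD _ _)).
rewrite normDn; apply: (le_trans (lerD h k)).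
rewrite mulrDl; apply: lerD; rewrite ler_pM2l//; first by rewrite lerDl.
by rewrite lerDr.
Qed.

Lemma RM_M B x y : RM B x -> RM B y -> RM B (fun e => x e * y e).
Proof.
move=> [b Bb Ob] [c Bc Oc].
have [s Bs Os] := is_gauge_mul (gaugeP B) Bb Bc.
exists s => //; apply: bigO_trans Os.
apply: evH2 Ob Oc => H K H0 K0; exists (H * K); first exact: mulr_gt0.
by move=> e h k; rewrite !normrM mulrACA ler_pM.
Qed.

Lemma negl_le Z x y : (forall e, `|x e| <= `|y e|) -> negl_net Z y -> negl_net Z x.
Proof.
move=> h ny z /ny O; apply: bigO_trans O.
by apply: (@bigO_le _ _ 1) => e; rewrite mul1r.
Qed.

Lemma negl0 Z : negl_net Z (fun=> 0).
Proof. by move=> z _; apply: (@bigO_le _ _ 0) => e; rewrite normr0 mul0r. Qed.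

Lemma negl_D Z x y : negl_net Z x -> negl_net Z y -> negl_net Z (fun e => x e + y e).
Proof.
move=> nx ny z pz; apply: evH2 (nx z pz) (ny z pz) => H K H0 K0.
exists (H + K); first exact: addr_gt0.
by move=> e h k; apply: (le_trans (ler_normD _ _)); rewrite mulrDl lerD.
Qed.

Lemma negl_M Z x y : RM Z x -> negl_net Z y -> negl_net Z (fun e => x e * y e).
Proof.
move=> [b Zb Ob] ny z [Zz pz].
have [q Zq Oq] := is_gauge_mul (gaugeP Z) Zb Zz.
have [p Zp [pp Op]] := is_gauge_add (gaugeP Z) Zq Zq.
have h1 : evH (fun H e => [/\ `|x e| <= H * `|b e|, 0 < z e & 0 < p e]).
  apply: (evH2 _ (_ : evH (fun H e => `|x e| <= H * `|b e| /\ 0 < z e)) (small_evH R pp)).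
    by move=> H1 H2 H10 _; exists H1 => // e [].
  by apply: evH2 Ob (small_evH R pz) => H1 H2 H10 _; exists H1.
have h2 : evH (fun H e => `|b e * z e| <= H * `|p e|).
  apply: bigO_trans Oq (bigO_trans _ Op).
  by apply: (@bigO_le _ _ 1) => e; rewrite mul1r normDn lerDl.
have h3 : evH (fun H e => `|x e| <= H * (p e / z e) /\ 0 < p e /\ 0 < z e).
  apply: evH2 h1 h2 => H K H0 K0; exists (H * K); first exact: mulr_gt0.
  move=> e [xb ze pe]; rewrite normrM (gtr0_norm ze) (gtr0_norm pe) => bz; split=> //.
  apply: (le_trans xb); rewrite -mulrA ler_pM2l// mulrA.
  by rewrite ler_pdivlMr.
apply: evH2 h3 (ny p (conj Zp pp)) => H K H0 K0; exists (H * K); first exact: mulr_gt0.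
move=> e [xb [pe ze]]; rewrite normrM !normfV (gtr0_norm pe) (gtr0_norm ze) => yb.
apply: le_trans (ler_pM _ _ xb yb) _ => //.
by rewrite mulrACA -mulrA [p e / z e]mulrC -mulrA divff ?mulr1 ?gt_eqF// mulrA.
Qed.

Lemma negl1 Z : ~ negl_net Z (fun=> 1).
Proof.
move=> n1.
have [i Zi li] := is_gauge_infty (gaugeP Z).
have [p Zp [pp Op]] := is_gauge_add (gaugeP Z) Zi Zi.
have h1 : evH (fun H e => `|i e| <= H * p e /\ 0 < p e).
  apply: evH2 Op (small_evH R pp) => K1 K2 K10 K20; exists K1 => // e.
  rewrite normDn => + pe; rewrite (gtr0_norm pe) => h.
  by split=> //; apply: le_trans h; rewrite lerDl.
have h2 : evH (fun H e => `|i e| <= H).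
  apply: evH2 h1 (n1 p (conj Zp pp)) => H K H0 K0.
  exists (H * K); first exact: mulr_gt0.
  move=> e [ip pe]; rewrite normr1 normfV (gtr0_norm pe) ler_pdivlMr// mul1r => pK.
  by apply: le_trans ip _; rewrite ler_pM2l.
have : evH (fun (_ : R) (_ : I) => False).
  apply: evH_lim h2 li => H H0; exists H => //; exists 1 => // e h1' h2'.
  by move: (lt_le_trans h2' h1'); rewrite ltxx.
by apply: (@evH_not_False R I (fun _ _ => False)) => ? ? _ [].
Qed.

Lemma negl_RM B Z x : negl_net Z x -> RM B x.
Proof.
move=> nx.
have [i Zi li] := is_gauge_infty (gaugeP Z).
have [p Zp [pp Op]] := is_gauge_add (gaugeP Z) Zi Zi.
have [b Bb O1] := RM_cst B 1.
exists b => //; apply: bigO_trans O1.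
have h1 : evH (fun H e => `|i e| <= H * p e /\ 0 < p e).
  apply: evH2 Op (small_evH R pp) => K1 K2 K10 K20; exists K1 => // e.
  rewrite normDn => + pe; rewrite (gtr0_norm pe) => h.
  by split=> //; apply: le_trans h; rewrite lerDl.
have h2 : evH (fun H e => `|x e| * `|i e| <= H).
  apply: evH2 h1 (nx p (conj Zp pp)) => H K H0 K0.
  exists (H * K); first exact: mulr_gt0.
  move=> e [ip pe]; rewrite normfV (gtr0_norm pe) ler_pdivlMr// => xp.
  apply: le_trans (_ : `|x e| * (H * p e) <= _); first by rewrite ler_wpM2l.
  by rewrite mulrCA ler_pM2l.
apply: evH_lim h2 li => H H0; exists 1 => //; exists H => // e h ie.
rewrite normr1 mulr1; apply: le_trans h; rewrite ler_peMr// ltW//.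
Qed.

End gauge_theory.

Section smooth_functions.
Variable R : realType.
Implicit Types (f g : R -> R) (K : set R).

Definition smooth f : Prop := forall (k : nat) (x : R), derivable (f^`(k)) x 1.

(* For K = set0 the value is 0, by the convention sup set0 = 0. *)
Definition sup_norm K f : R := sup [set `|f x| | x in K].

Lemma smooth_derivable f : smooth f -> forall x, derivable f x 1.
Proof. by move=> sf x; exact: (sf 0%N). Qed.

Lemma smooth_continuous f : smooth f -> continuous f.
Proof.
move=> sf x; apply: differentiable_continuous.
exact/derivable1_diffP/smooth_derivable.
Qed.

Lemma smooth_derive1n k f : smooth f -> smooth (f^`(k)).
Proof.
move=> sf m x; have -> : (f^`(k))^`(m) = f^`(m + k)%N.
  by rewrite /derive1n iterD.
exact: sf.
Qed.

Lemma smooth_derive1 f : smooth f -> smooth (f^`()).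
Proof. exact: (@smooth_derive1n 1). Qed.

Lemma derive1_cstE (c : R) : (cst c : R -> R)^`() = cst 0.
Proof. by apply/funext => x; rewrite derive1_cst. Qed.

Lemma derive1n_cst (c : R) k : (cst c : R -> R)^`(k) = cst (if k == 0%N then c else 0).
Proof.
elim: k => // k IH; rewrite derive1nS IH derive1_cstE.
by [].
Qed.

Lemma smooth_cst (c : R) : smooth (cst c).
Proof. by move=> k x; rewrite derive1n_cst; exact: derivable_cst. Qed.

Lemma derive1_add f g : smooth f -> smooth g -> derive1 (f + g) = derive1 f + derive1 g.
Proof.
move=> sf sg; apply/funext => x; rewrite derive1E deriveD; first by rewrite -!derive1E.
- exact: smooth_derivable.
- exact: smooth_derivable.
Qed.

Lemma derive1_mul f g : smooth f -> smooth g ->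
  derive1 (f * g) = derive1 f * g + f * derive1 g.
Proof.
move=> sf sg; apply/funext => x; rewrite derive1E deriveM.
- by rewrite -!derive1E addrC [_ *: derive1 f x]mulrC.
- exact: smooth_derivable.
- exact: smooth_derivable.
Qed.

Lemma derive1n_addW k f g :
  (forall m x, (m < k)%N -> derivable (derive1n m f) x 1 /\ derivable (derive1n m g) x 1) ->
  derive1n k (f + g) = derive1n k f + derive1n k g.
Proof.
elim: k => // k IH h; rewrite derive1nS IH => [|m x mk]; last exact: h (ltnW mk).
apply/funext => x; have [df dg] := h k x (ltnSn k).
by rewrite derive1E deriveD// -!derive1E.
Qed.

Lemma derive1n_add k f g : smooth f -> smooth g ->
  derive1n k (f + g) = derive1n k f + derive1n k g.
Proof. by move=> sf sg; apply: derive1n_addW => m x _; split; [exact: sf|exact: sg]. Qed.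

Lemma smooth_add f g : smooth f -> smooth g -> smooth (f + g).
Proof.
move=> sf sg k x; rewrite derive1n_add//.
by apply: derivableD; [exact: sf|exact: sg].
Qed.

Lemma smooth_mul f g : smooth f -> smooth g -> smooth (f * g).
Proof.
suff h k : forall f g, smooth f -> smooth g ->
    forall m x, (m <= k)%N -> derivable (derive1n m (f * g)) x 1.
  by move=> sf sg k x; exact: (h k).
elim: k => [|k IH] {}f {}g sf sg [|m] x mk //.
- by apply: derivableM; exact: smooth_derivable.
- by apply: derivableM; exact: smooth_derivable.
have [sf' sg'] := (smooth_derive1 sf, smooth_derive1 sg).
have dm y l : (l <= m)%N -> derivable (derive1n l (derive1 f * g)) y 1 /\
    derivable (derive1n l (f * derive1 g)) y 1.
  by move=> lm; split; apply: IH => //; exact: leq_trans lm mk.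
rewrite derive1Sn derive1_mul// derive1n_addW.
  by have [d1 d2] := dm x m (leqnn m); exact: (derivableD d1 d2).
by move=> l y /ltnW lm; exact: dm.
Qed.

Lemma sup_norm_le K f (M : R) : 0 <= M -> (forall x, K x -> `|f x| <= M) ->
  sup_norm K f <= M.
Proof.
move=> M0 h; have [[x Kx]|/nonemptyPn K0] := pselect (K !=set0).
  by apply: ge_sup; [exists `|f x|, x|move=> _ [y Ky <-]; exact: h].
by rewrite /sup_norm K0 image_set0 sup0.
Qed.

Lemma le_sup_norm K f x : compact K -> continuous f -> K x ->
  `|f x| <= sup_norm K f.
Proof.
move=> cK cf Kx; apply: ub_le_sup; last by exists x.
have : compact [set `|f x| | x in K].
  apply: (@continuous_compact _ _ (fun x => `|f x|)) => //.
  apply: continuous_subspaceT => y; apply: continuous_comp; first exact: cf.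
  exact: norm_continuous.
by move=> cfK; apply: (compact_has_sup _ cfK).2; exists `|f x|, x.
Qed.

Lemma sup_norm_ge0 K f : compact K -> continuous f -> 0 <= sup_norm K f.
Proof.
move=> cK cf; have [[x Kx]|/nonemptyPn K0] := pselect (K !=set0).
  by apply: le_trans (le_sup_norm cK cf Kx).
by rewrite /sup_norm K0 image_set0 sup0.
Qed.

Lemma sup_norm_add K f g : compact K -> continuous f -> continuous g ->
  sup_norm K (f + g) <= sup_norm K f + sup_norm K g.
Proof.
move=> cK cf cg; apply: sup_norm_le; first by rewrite addr_ge0 ?sup_norm_ge0.
by move=> x Kx; apply: (le_trans (ler_normD _ _)); apply: lerD; exact: le_sup_norm.
Qed.

Lemma sup_norm_mul K f g : compact K -> continuous f -> continuous g ->
  sup_norm K (f * g) <= sup_norm K f * sup_norm K g.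
Proof.
move=> cK cf cg; apply: sup_norm_le; first by rewrite mulr_ge0 ?sup_norm_ge0.
by move=> x Kx; rewrite normrM; apply: ler_pM => //; exact: le_sup_norm.
Qed.

End smooth_functions.

Section generalized_functions.
Variables (R : realType) (I : index_set).
Implicit Types (B Z : gauge R I) (u v : I -> R -> R).

Definition moderate_fun B u : Prop :=
  (forall e, smooth (u e)) /\
  forall (K : set R) (k : nat), compact K ->
    RM B (fun e => sup_norm K ((u e)^`(k))).

Definition negligible_fun Z u : Prop :=
  (forall e, smooth (u e)) /\
  forall (K : set R) (k : nat), compact K ->
    negl_net Z (fun e => sup_norm K ((u e)^`(k))).

Definition net_derive u : I -> R -> R := fun e => (u e)^`().

Lemma net_le (x y : R) : 0 <= x -> x <= y -> `|x| <= `|y|.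
Proof. by move=> x0 xy; rewrite !ger0_norm// (le_trans x0). Qed.

Lemma sup_norm_kge0 K k f : compact K -> smooth f -> 0 <= sup_norm K (f^`(k)) :> R.
Proof. by move=> cK sf; apply/sup_norm_ge0/smooth_continuous/smooth_derive1n. Qed.

Lemma moderate_derive B u : moderate_fun B u -> moderate_fun B (net_derive u).
Proof.
move=> [su hu]; split=> [e|K k cK]; first exact: smooth_derive1.
by have := hu K k.+1 cK; apply: RM_le => e; rewrite derive1Sn.
Qed.

Lemma negligible_derive Z u : negligible_fun Z u -> negligible_fun Z (net_derive u).
Proof.
move=> [su hu]; split=> [e|K k cK]; first exact: smooth_derive1.
by have := hu K k.+1 cK; apply: negl_le => e; rewrite derive1Sn.
Qed.

Lemma moderate_cst B (x : I -> R) : RM B x -> moderate_fun B (fun e => cst (x e)).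
Proof.
move=> Bx; split=> [e|K k cK]; first exact: smooth_cst.
apply: RM_le Bx => e; rewrite ger0_norm; last first.
  by apply: sup_norm_kge0 => //; exact: smooth_cst.
apply: sup_norm_le => // y _; rewrite derive1n_cst.
by case: ifP => // _; rewrite normr0.
Qed.

Lemma moderateD B u v : moderate_fun B u -> moderate_fun B v -> moderate_fun B (u + v).
Proof.
move=> [su hu] [sv hv]; split=> [e|K k cK]; first exact: smooth_add.
apply: RM_le (RM_D (hu K k cK) (hv K k cK)) => e.
apply: net_le; first by apply: sup_norm_kge0 => //; exact: smooth_add.
rewrite derive1n_add//; apply: sup_norm_add => //;
  exact/smooth_continuous/smooth_derive1n.
Qed.

Lemma negligibleD Z u v : negligible_fun Z u -> negligible_fun Z v -> negligible_fun Z (u + v).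
Proof.
move=> [su hu] [sv hv]; split=> [e|K k cK]; first exact: smooth_add.
apply: negl_le (negl_D (hu K k cK) (hv K k cK)) => e.
apply: net_le; first by apply: sup_norm_kge0 => //; exact: smooth_add.
rewrite derive1n_add//; apply: sup_norm_add => //;
  exact/smooth_continuous/smooth_derive1n.
Qed.

Lemma net_derive_mul u v : (forall e, smooth (u e)) -> (forall e, smooth (v e)) ->
  net_derive (u * v) = net_derive u * v + u * net_derive v.
Proof. by move=> su sv; apply/funext => e; exact: derive1_mul. Qed.

Lemma moderateM B u v : moderate_fun B u -> moderate_fun B v -> moderate_fun B (u * v).
Proof.
move=> mu mv; split=> [e|K k cK]; first by apply: smooth_mul; [exact: mu.1|exact: mv.1].
elim: k u v mu mv => [|k IH] u v mu mv; have [[su hu] [sv hv]] := (mu, mv).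
  apply: RM_le (RM_M (hu K 0%N cK) (hv K 0%N cK)) => e.
  apply: net_le; first by apply: sup_norm_kge0 => //; exact: smooth_mul.
  by apply: sup_norm_mul => //; exact: smooth_continuous.
have [mu' mv'] := (moderate_derive mu, moderate_derive mv).
apply: RM_le (RM_D (IH _ _ mu' mv) (IH _ _ mu mv')) => e.
apply: net_le; first by apply: sup_norm_kge0 => //; exact: smooth_mul.
rewrite derive1Sn derive1_mul// derive1n_add.
- apply: sup_norm_add => //; apply/smooth_continuous/smooth_derive1n/smooth_mul => //;
  exact: smooth_derive1.
- by apply: smooth_mul => //; exact: smooth_derive1.
- by apply: smooth_mul => //; exact: smooth_derive1.
Qed.

Lemma negligibleM Z u v : moderate_fun Z u -> negligible_fun Z v -> negligible_fun Z (u * v).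
Proof.
move=> mu mv; split=> [e|K k cK]; first by apply: smooth_mul; [exact: mu.1|exact: mv.1].
elim: k u v mu mv => [|k IH] u v mu mv; have [[su hu] [sv hv]] := (mu, mv).
  apply: negl_le (negl_M (hu K 0%N cK) (hv K 0%N cK)) => e.
  apply: net_le; first by apply: sup_norm_kge0 => //; exact: smooth_mul.
  by apply: sup_norm_mul => //; exact: smooth_continuous.
have [mu' mv'] := (moderate_derive mu, negligible_derive mv).
apply: negl_le (negl_D (IH _ _ mu' mv) (IH _ _ mu mv')) => e.
apply: net_le; first by apply: sup_norm_kge0 => //; exact: smooth_mul.
rewrite derive1Sn derive1_mul// derive1n_add.
- apply: sup_norm_add => //; apply/smooth_continuous/smooth_derive1n/smooth_mul => //;
  exact: smooth_derive1.
- by apply: smooth_mul => //; exact: smooth_derive1.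
- by apply: smooth_mul => //; exact: smooth_derive1.
Qed.

Lemma negligible0 Z : negligible_fun Z 0.
Proof.
split=> [e|K k cK]; first exact: smooth_cst.
apply: negl_le (@negl0 R I Z) => e; apply: net_le.
  by apply: sup_norm_kge0 => //; exact: smooth_cst.
by apply: sup_norm_le => // x _; rewrite derive1n_cst if_same normr0.
Qed.

Lemma negligible1 Z : ~ negligible_fun Z 1.
Proof.
move=> [_ h]; apply: (@negl1 R I Z).
have := h [set 0] 0%N (@compact_set1 _ _); apply: negl_le => e.
apply: net_le => //; rewrite -[leLHS]normr1.
apply: (@le_sup_norm _ _ _ 0) => //; first exact: compact_set1.
by apply: smooth_continuous; exact: smooth_cst.
Qed.

Lemma moderate_mono B B' u : gset B `<=` RM B' -> moderate_fun B u -> moderate_fun B' u.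
Proof.
move=> BB' [su hu]; split=> // K k cK.
have [b /BB'[c Bc Oc] Ob] := hu K k cK.
by exists c => //; exact: bigO_trans Ob Oc.
Qed.

Lemma RM_gset B : gset B `<=` RM B.
Proof. by move=> b Bb; exists b => //; apply: (@bigO_le _ _ _ _ 1) => e; rewrite mul1r. Qed.

Definition moderate_pred B : {pred I -> R -> R} := fun u => `[< moderate_fun B u >].

Lemma moderate_subring B : subring_closed (moderate_pred B).
Proof.
have m1 : moderate_fun B 1 by apply: moderate_cst; exact: RM_cst.
have mN1 : moderate_fun B (- 1).
  have -> : - 1 = (fun e : I => cst (-1)) :> (I -> R -> R) by [].
  by apply: moderate_cst; exact: RM_cst.
split; first exact/asboolP.
- move=> u v /asboolP mu /asboolP mv; apply/asboolP.
  by apply: moderateD => //; rewrite -mulN1r; exact: moderateM.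
- by move=> u v /asboolP mu /asboolP mv; apply/asboolP; exact: moderateM.
Qed.

Record EM_alg B := MkEM { EM_val :> I -> R -> R ; EM_valP : EM_val \in moderate_pred B }.

HB.instance Definition _ B := [isSub for @EM_val B].
HB.instance Definition _ B := [Choice of EM_alg B by <:].
HB.instance Definition _ B :=
  GRing.SubChoice_isSubComPzRing.Build _ _ (EM_alg B) (moderate_subring B).

Lemma EM_moderate B (u : EM_alg B) : moderate_fun B u.
Proof. exact/asboolP/EM_valP. Qed.

Definition mkEM B u (h : moderate_fun B u) : EM_alg B := MkEM (asboolT h).

Lemma EM_oner_neq0 B : 1 != 0 :> EM_alg B.
Proof.
apply/eqP => /(congr1 (@EM_val B)) h.
have [e _] := is_index_set_nonempty (index_setP I).
have /(congr1 (fun u : I -> R -> R => u e 0)) := h.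
by move/eqP; rewrite /= oner_eq0.
Qed.

HB.instance Definition _ B := GRing.PzSemiRing_isNonZero.Build (EM_alg B) (@EM_oner_neq0 B).

Definition EM_derive B (u : EM_alg B) : EM_alg B := mkEM (moderate_derive (EM_moderate u)).

(* Data of a Colombeau algebra over the real line; the algebra itself is gf C. *)
Record colombeau := Colombeau {
  mod_gauge : gauge R I ;
  neg_gauge : gauge R I ;
  gauge_incl : RM mod_gauge `<=` RM neg_gauge
}.

Definition negligible_pred (C : colombeau) : {pred EM_alg (mod_gauge C)} :=
  fun u : EM_alg (mod_gauge C) => `[< negligible_fun (neg_gauge C) u >].

Lemma negligible_idealr C : idealr_closed (@negligible_pred C).
Proof.
split; first exact/asboolP/negligible0.
  by apply/asboolPn; exact: negligible1.
move=> a u v /asboolP nu /asboolP nv; apply/asboolP.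
change (negligible_fun (neg_gauge C) (EM_val a * EM_val u + EM_val v)).
apply: negligibleD => //; apply: negligibleM => //.
apply: moderate_mono (EM_moderate a).
by apply: subset_trans (@gauge_incl C); exact: RM_gset.
Qed.

HB.instance Definition _ C := isIdealr.Build _ (@negligible_pred C) (negligible_idealr C).

Definition gf (C : colombeau) := {ideal_quot (@negligible_pred C)}.
HB.instance Definition _ C := GRing.ComNzRing.on (gf C).

Definition gf_class C (u : EM_alg (mod_gauge C)) : gf C :=
  (\pi_({ideal_quot (@negligible_pred C)}) u)%qT.

Lemma gf_classP C (u v : EM_alg (mod_gauge C)) :
  gf_class u = gf_class v <-> negligible_fun (neg_gauge C) ((u : I -> R -> R) - v).
Proof.
rewrite -[negligible_fun _ _]/(negligible_fun (neg_gauge C) (EM_val (u - v))); split.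
- move=> uv; apply/asboolP; rewrite -[asbool _]/((u - v) \in @negligible_pred C).
  by rewrite Quotient.idealrBE; apply/eqP.
- move=> /asboolT uv; apply/eqP; rewrite -Quotient.idealrBE.
  exact: uv.
Qed.

Definition gf_derive C (x : gf C) : gf C := gf_class (EM_derive (repr x)).

Lemma gf_deriveE C (u : EM_alg (mod_gauge C)) :
  gf_derive (gf_class u) = gf_class (EM_derive u).
Proof.
have /gf_classP/negligible_derive : gf_class (repr (gf_class u)) = gf_class u.
  exact: reprK.
rewrite /gf_derive; set v := repr _ => nuv; apply/gf_classP.
have [mu mv] := (EM_moderate u, EM_moderate v).
suff -> : (EM_derive v : I -> R -> R) - EM_derive u = net_derive ((v : I -> R -> R) - u) by [].
apply/funext => e; apply/funext => t; rewrite /= /net_derive !derive1E deriveB.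
- by rewrite -!derive1E.
- exact: smooth_derivable (mv.1 e) t.
- exact: smooth_derivable (mu.1 e) t.
Qed.

Definition gf_const B C (h : RM B `<=` RM (mod_gauge C)) (x : RM B) : gf C :=
  gf_class (mkEM (moderate_cst (h _ (set_valP x)))).

(* x consists of representatives; the initial condition holds up to negligible
   nets of reals, the equation in the quotient. *)
Definition ode_solution B C (h : RM B `<=` RM (mod_gauge C)) (d : nat) (t0 : R)
    (A : 'M[RM B]_d) (c : 'cV[RM B]_d) (x : 'cV[EM_alg (mod_gauge C)]_d) : Prop :=
  let X : 'cV[gf C]_d := map_mx (@gf_class C) x in
  map_mx (@gf_derive C) X + map_mx (gf_const h) A *m X = 0 /\
  forall i : 'I_d, negl_net (neg_gauge C) (fun e => EM_val (x i 0) e t0 - val (c i 0) e).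

Definition linear_odes_solvable B C : Prop :=
  exists h : RM B `<=` RM (mod_gauge C),
    forall (d : nat), (0 < d)%N ->
    forall (t0 : R) (A : 'M[RM B]_d) (c : 'cV[RM B]_d),
    exists x : 'cV[EM_alg (mod_gauge C)]_d, ode_solution h t0 A c x.

Definition colombeau_le C C' : Prop :=
  [/\ RM (mod_gauge C) `<=` RM (neg_gauge C), RM (mod_gauge C') `<=` RM (neg_gauge C'),
      RM (mod_gauge C) `<=` RM (mod_gauge C') & RM (neg_gauge C) `<=` RM (neg_gauge C')].

Definition colombeau_diag B : colombeau := Colombeau (@subset_refl _ (RM B)).

End generalized_functions.

(* Main.v *)
Require Import Defs.
From mathcomp Require Import all_boot all_order all_algebra.
From mathcomp Require Import all_classical all_reals all_analysis.
From mathcomp Require Import generic_quotient ring_quotient.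
From mathcomp Require Import ring lra.

Set Implicit Arguments.
Unset Strict Implicit.
Unset Printing Implicit Defensive.

Import Order.TTheory GRing.Theory Num.Theory.
Import numFieldNormedType.Exports.

Local Open Scope ring_scope.
Local Open Scope classical_set_scope.

(** Fix the index e: a linear system x' + A x = 0, x(t0) = c is solved by
    exp(-(t - t0) A) c, whose k-th derivative at t is at most
    |c| |A|^k exp(|A| |t - t0|), for |.| the sum of the absolute values of the
    entries. If the coefficients are in RM B, then |A_e| is eventually below some
    p_e with p in B, so on compact sets these derivatives grow at most like
    exp(H p_e), up to the factors |c_e| and |A_e|^k that exp_gauge B absorbs as
    well. Hence the pointwise solutions form a moderate net (moderate_net_flow), which solves
    the problem exactly, and not just up to negligible nets
    (linear_odes_solvable_exp).

    Conversely, minimality needs only the scalar problem x' - p x = 0, x(0) = 1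
    with p a positive net of B. A solution in any Colombeau algebra satisfies it
    up to errors that are eventually at most 1/4 on [0, 1], and such an
    approximate solution still reaches half of exp p at time 1
    (exp_le_perturbed_solution). As x(1) is moderate, exp p is dominated by the
    moderateness gauge of the algebra; every element of RM (exp_gauge B) is
    dominated by some exp p (exp_gauge_dominated), so RM (exp_gauge B) lies in
    RM of that gauge (solvable_RM_exp). The inclusion for the second gauge
    follows, because it contains the first one in every Colombeau algebra. *)

(** * Exponential generating functions *)

Section exponential_generating_functions.
Variable R : realType.
Implicit Types (a : nat -> R) (C M t : R).

(** Solutions of linear systems are written coordinatewise through the sequence a
    of their derivatives at the initial time: differentiating the sum of
    a_k t^k / k! then merely shifts a. *)
Definition egf a t : R := limn (pseries (fun k => a k / k`!%:R) t).

(** For such sequences the series is dominated by C times the exponential series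
    at M |t|, which gives convergence everywhere and the growth estimate at
    once. *)
Definition geo_bounded C M a : Prop := forall k, `|a k| <= C * M ^+ k.

Lemma geo_bounded_shift C M n a : geo_bounded C M a ->
  geo_bounded (C * M ^+ n) M (fun k => a (k + n)%N).
Proof.
by move=> h k; apply: (le_trans (h _)); rewrite exprD mulrA mulrAC.
Qed.

Lemma egf_term_le C M a t : geo_bounded C M a ->
  forall k, `|a k / k`!%:R * t ^+ k| <= C * exp_coeff (M * `|t|) k.
Proof.
move=> h k; rewrite /exp_coeff /= !normrM normrX normfV normr_nat.
rewrite exprMn [leRHS](_ : _ = (C * M ^+ k) / k`!%:R * `|t| ^+ k); last by ring.
by rewrite !ler_wpM2r ?exprn_ge0 ?invr_ge0.
Qed.

Lemma egf_cvg_norm C M a t : geo_bounded C M a ->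
  cvgn (series (fun k => `|a k / k`!%:R * t ^+ k|)).
Proof.
move=> h; apply: series_le_cvg (egf_term_le t h) _ => [//|n|].
  exact: le_trans (egf_term_le t h n).
exact: (@is_cvg_seriesZ _ _ C (is_cvg_series_exp_coeff (M * `|t|))).
Qed.

Lemma egf_cvg C M a t : geo_bounded C M a ->
  cvgn (pseries (fun k => a k / k`!%:R) t).
Proof. by move=> h; exact: normed_cvg (egf_cvg_norm h). Qed.

Lemma egf_le C M a t : geo_bounded C M a -> `|egf a t| <= C * expR (M * `|t|).
Proof.
move=> h; apply: (le_trans (lim_series_norm (egf_cvg_norm h))).
have ce := is_cvg_series_exp_coeff (M * `|t|).
have <- : limn (series (C *: exp_coeff (M * `|t|))) = C * expR (M * `|t|).
  by rewrite lim_seriesZ.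
apply: lim_series_le (egf_cvg_norm h) _ (egf_term_le t h).
exact: (@is_cvg_seriesZ _ _ C ce).
Qed.

Lemma egf_at0 a : egf a 0 = a 0%N.
Proof.
apply: lim_near_cst => //; near=> n; rewrite /pseries /series /=.
rewrite -[n]prednK; last by near: n; exact: nbhs_infty_gt.
rewrite big_nat_recl// big1 => [|i _]; last by rewrite expr0n mulr0.
by rewrite addr0 expr0 fact0 divr1 mulr1.
Unshelve. all: by end_near. Qed.

Lemma pseries_diffs_egf a :
  pseries_diffs (fun k => a k / k`!%:R) = (fun k => a k.+1 / k`!%:R).
Proof.
apply/funext => k; rewrite /pseries_diffs factS natrM invfM mulrCA mulrA.
by rewrite mulrA mulfK// mulrC.
Qed.

(** Termwise differentiation inside the disc of convergence, applied with radius
    |t| + 1; the shifted sequences are again geometrically bounded. *)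
Lemma is_derive_egf C M a t : geo_bounded C M a ->
  is_derive t (1 : R) (egf a) (egf (fun k => a k.+1) t).
Proof.
move=> h; rewrite /egf -pseries_diffs_egf.
have h1 : geo_bounded (C * M ^+ 1) M (fun k => a k.+1).
  by move=> k; have := geo_bounded_shift 1 h k; rewrite addn1.
have h2 : geo_bounded (C * M ^+ 1 * M ^+ 1) M (fun k => a k.+2).
  by move=> k; have := geo_bounded_shift 1 h1 k; rewrite addn1.
apply: (@pseries_snd_diffs _ _ (`|t| + 1)).
- exact: (egf_cvg h).
- rewrite pseries_diffs_egf; exact: (egf_cvg h1).
- rewrite 2!pseries_diffs_egf; exact: (egf_cvg h2).
- by rewrite [ltRHS]ger0_norm ?addr_ge0// ltrDl.
Qed.

Lemma is_derive_egf_shift C M a t0 t : geo_bounded C M a ->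
  is_derive t (1 : R) (fun s => egf a (s - t0)) (egf (fun k => a k.+1) (t - t0)).
Proof.
move=> h; have d := is_derive_egf (t - t0) h.
have := @is_derive1_comp _ _ (center t0) _ _ _ d (is_derive_shift t 1 (- t0)).
by rewrite mulr1.
Qed.

Lemma derive1n_egf_shift C M a t0 n : geo_bounded C M a ->
  (fun s => egf a (s - t0))^`(n) = (fun s => egf (fun k => a (k + n)%N) (s - t0)).
Proof.
move=> h; elim: n => [|n IH].
  by apply/funext => s /=; congr (egf _ _); apply/funext => k; rewrite addn0.
rewrite derive1nS IH; apply/funext => s; rewrite derive1E.
have [_ ->] := is_derive_egf_shift t0 s (geo_bounded_shift n h).
by congr (egf _ _); apply/funext => k; rewrite addSnnS.
Qed.

Lemma smooth_egf_shift C M a t0 : geo_bounded C M a ->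
  smooth (fun s => egf a (s - t0)).
Proof.
move=> h n x; rewrite (derive1n_egf_shift _ _ h).
by have [] := is_derive_egf_shift t0 x (geo_bounded_shift n h).
Qed.

Lemma egf_scale_sum (J : finType) (w : J -> R) (a : J -> nat -> R) C M t :
  (forall j, geo_bounded C M (a j)) ->
  egf (fun k => \sum_j w j * a j k) t = \sum_j w j * egf (a j) t.
Proof.
move=> h; apply: cvg_lim => //.
rewrite (_ : pseries _ _ = fun n => \sum_j w j * pseries (fun k => a j k / k`!%:R) t n).
  apply: cvg_big => [|j _]; first exact: add_continuous.
  apply: cvgMl_tmp.
  exact: (egf_cvg (h j)).
apply/funext => n; rewrite /pseries /series /=.
under [RHS]eq_bigr do rewrite mulr_sumr.
rewrite exchange_big /=; apply: eq_bigr => k _.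
by rewrite !mulr_suml; apply: eq_bigr => j _; rewrite !mulrA.
Qed.

End exponential_generating_functions.

(** * The flow of a linear system with constant coefficients *)

Section linear_systems.
Variables (R : realType) (d : nat).
Implicit Types (A : 'M[R]_d) (c : 'cV[R]_d).

Definition mx_sum_norm m n (A : 'M[R]_(m, n)) : R := \sum_i \sum_j `|A i j|.

Lemma mx_sum_norm_ge0 m n (A : 'M[R]_(m, n)) : 0 <= mx_sum_norm A.
Proof. by rewrite !sumr_ge0// => i _; rewrite sumr_ge0. Qed.

Lemma row_sum_norm_le m n (A : 'M[R]_(m, n)) i : \sum_j `|A i j| <= mx_sum_norm A.
Proof.
rewrite /mx_sum_norm (bigD1 i)//= lerDl.
by rewrite !sumr_ge0// => k _; rewrite sumr_ge0.
Qed.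

(** The entries of (- A)^k c, which is the k-th derivative of the solution at
    the initial time. *)
Definition taylor_coef A c (i : 'I_d) (k : nat) : R := iter k (mulmx (- A)) c i 0.

Lemma taylor_coefS A c i k :
  taylor_coef A c i k.+1 = \sum_j - A i j * taylor_coef A c j k.
Proof. by rewrite /taylor_coef iterS mxE; apply: eq_bigr => j _; rewrite !mxE. Qed.

Lemma taylor_coef_bounded A c i :
  geo_bounded (mx_sum_norm c) (mx_sum_norm A) (taylor_coef A c i).
Proof.
move=> k; elim: k i => [|k IH] i.
  rewrite expr0 mulr1; apply: le_trans (row_sum_norm_le c i).
  by rewrite big_ord1.
rewrite taylor_coefS; apply: (le_trans (ler_norm_sum _ _ _)).
rewrite exprS mulrCA; apply: le_trans (_ : (\sum_j `|A i j|) * _ <= _); last first.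
  apply: ler_wpM2r (row_sum_norm_le A i).
  by rewrite mulr_ge0 ?exprn_ge0 ?mx_sum_norm_ge0.
rewrite mulr_suml; apply: ler_sum => j _; rewrite normrM normrN.
by apply: ler_wpM2l => //; exact: IH.
Qed.

Definition linear_flow A c (t0 : R) (i : 'I_d) (t : R) : R :=
  egf (taylor_coef A c i) (t - t0).

Lemma linear_flow_init A c t0 i : linear_flow A c t0 i t0 = c i 0.
Proof. by rewrite /linear_flow subrr egf_at0. Qed.

Lemma smooth_linear_flow A c t0 i : smooth (linear_flow A c t0 i).
Proof. exact: smooth_egf_shift (taylor_coef_bounded A c i). Qed.

(** One more factor - A is one more shift of the coefficient sequence, so the
    equation is the termwise derivative combined with linearity of egf. *)
Lemma derive1_linear_flow A c t0 i t :
  (linear_flow A c t0 i)^`() t = \sum_j - A i j * linear_flow A c t0 j t.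
Proof.
rewrite -[LHS]/((fun s => egf (taylor_coef A c i) (s - t0))^`(1) t).
rewrite (derive1n_egf_shift t0 1 (taylor_coef_bounded A c i)).
rewrite /linear_flow -(egf_scale_sum _ _ (taylor_coef_bounded A c)).
by congr (egf _ _); apply/funext => k; rewrite addn1 taylor_coefS.
Qed.

Lemma derive1n_linear_flow_le A c t0 i k t :
  `|derive1n k (linear_flow A c t0 i) t| <=
  mx_sum_norm c * mx_sum_norm A ^+ k * expR (mx_sum_norm A * `|t - t0|).
Proof.
have h := taylor_coef_bounded A c i.
rewrite (derive1n_egf_shift t0 k h).
exact: egf_le (geo_bounded_shift k h).
Qed.

End linear_systems.

(** * Growth of approximate solutions *)

Section exponential_growth.
Variable R : realType.

(** Variation of constants without an integral: y(t) = exp(- p t) f(t) has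
    derivative exp(- p t) (f' - p f), of size at most 1/4 since p >= 0. By the
    mean value theorem y(1) >= y(0) - 1/4 >= 1/2. *)
Lemma exp_le_perturbed_solution (f : R -> R) (p : R) : smooth f -> 0 <= p ->
  (forall t, t \in `[0, 1]%R -> `|derive1 f t - p * f t| <= 4^-1) ->
  `|f 0 - 1| <= 4^-1 -> expR p <= 2 * f 1.
Proof.
move=> sf p0 hres hinit.
pose y t := expR (- p * t) * f t.
pose dy t := expR (- p * t) * (derive1 f t - p * f t).
have yE t : is_derive t (1 : R) y (dy t).
  have df : is_derive t (1 : R) f (derive1 f t).
    by apply: DeriveDef; [exact: smooth_derivable|rewrite derive1E].
  have de : is_derive t (1 : R) (fun s => expR (- p * s)) (expR (- p * t) * (- p)).
    apply: (@is_derive1_comp _ expR (fun s => - p * s)).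
    have := is_deriveZ (- p) (is_derive_id t (1 : R)); rewrite /GRing.scale/= mulr1.
    exact.
  have := is_deriveM de df; rewrite /GRing.scale/= /dy.
  suff -> : expR (- p * t) * derive1 f t + f t * (expR (- p * t) * - p) =
    expR (- p * t) * (derive1 f t - p * f t) by [].
  by ring.
have cy : {within `[0 : R, 1], continuous y}.
  apply: derivable_within_continuous => t _.
  by have [] := yE t.
have [t t01] := MVT_segment ler01 (fun t _ => yE t) cy.
rewrite subr0 mulr1 /y mulr0 expR0 mul1r mulr1 => yinc.
have dy_le : `|dy t| <= 4^-1.
  rewrite /dy normrM (gtr0_norm (expR_gt0 _)) -[leRHS]mul1r.
  apply: ler_pM => //; last exact: hres.
  rewrite -expR0 ler_expR mulNr oppr_le0 mulr_ge0//.
  by move: t01; rewrite in_itv/= => /andP[].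
have : 2^-1 <= expR (- p) * f 1.
  move: dy_le hinit; rewrite !ler_norml => /andP[d1 d2] /andP[i1 i2].
  by move: yinc d1 i1; lra.
rewrite expRN mulrC ler_pdivlMr ?expR_gt0// => h.
by rewrite -(ler_pM2l (_ : 0 < 2^-1 :> R))// mulKf.
Qed.

End exponential_growth.

(** * Growth of nets with respect to a gauge *)

Lemma for_small2 (I : index_set) (P Q S : I -> Prop) :
  (forall e, P e -> Q e -> S e) -> for_small P -> for_small Q -> for_small S.
Proof.
move=> PQS [A1 F1 h1] [A2 F2 h2].
have [D FD DA] := is_index_set_cap (index_setP I) F1 F2.
exists D => // a Da; have [e1 e1a k1] := h1 a (DA _ Da).1.
have [d1 [d1e1 Dd1]] := below_ne FD Da e1a.
have [e2 e2d k2] := h2 d1 (DA _ Dd1).2.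
exists e2; first exact: ile_trans e2d (ile_trans d1e1 e1a).
move=> e [ee2 De]; apply: PQS.
- apply: k1; split; last exact: (DA _ De).1.
  exact: ile_trans ee2 (ile_trans e2d d1e1).
- by apply: k2; split=> //; exact: (DA _ De).2.
Qed.

Section gauge_growth.
Variables (R : realType) (I : index_set).
Implicit Types (B Z : gauge R I) (x y : I -> R).

Lemma RM_small_le B x y (H : R) : for_small (fun e => `|x e| <= H * `|y e|) ->
  RM B y -> RM B x.
Proof.
move=> hxy [b Bb O]; exists b => //; apply: bigO_trans O.
apply: evH1 (small_evH R hxy) => _ _; exists (`|H| + 1); first by rewrite ltr_wpDl.
move=> e h; apply: (le_trans h); apply: ler_wpM2r => //.
by rewrite (le_trans (ler_norm _))// lerDl.
Qed.

Lemma RM_sum B (J : finType) (x : J -> I -> R) : (forall j, RM B (x j)) ->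
  RM B (fun e => \sum_j x j e).
Proof.
move=> h; rewrite (_ : (fun e => _) = \sum_j x j); last first.
  by apply/funext => e; rewrite fct_sumE.
by apply: (big_ind (RM B)) => [|u v|j _]; [exact: RM_cst|exact: RM_D|exact: h].
Qed.

Lemma RM_X B x n : RM B x -> RM B (fun e => x e ^+ n).
Proof.
move=> h; elim: n => [|n IH].
  rewrite (_ : (fun _ => _) = fun=> 1); first exact: RM_cst.
  by apply/funext => e; rewrite expr0.
rewrite (_ : (fun _ => _) = fun e => x e * x e ^+ n); first exact: RM_M.
by apply/funext => e; rewrite exprS.
Qed.

Lemma bigO_refl x : bigO_net x x.
Proof. by apply: (@bigO_le _ _ _ _ 1) => e; rewrite mul1r. Qed.

(** The constant of a big-O may depend on the index a, so it cannot be taken out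
    as a scalar; a larger element of the gauge absorbs all of them. This is what
    makes it possible to exponentiate big-O estimates. *)
Lemma gauge_dominates B b x : gset B b -> bigO_net x b ->
  exists2 p, gauge_pos B p & for_small (fun e => `|x e| <= p e).
Proof.
move=> Bb O; have [p pB hp] := gauge_absorb Bb; exists p => //.
apply: for_small2 (hp _ O) (hp _ O) => e [H _ [h [hp' _]]] _.
exact: le_trans hp'.
Qed.

Lemma RM_expR B x (r : R) : RM B x -> RM (exp_gauge B) (fun e => expR (r * x e)).
Proof.
move=> Bx.
have [b Bb O] : RM B (fun e => r * x e) by apply: RM_M => //; exact: RM_cst.
have [p [Bp _] hp] := gauge_dominates Bb O.
exists (fun e => expR (1 * p e)); first by exists 1 => //; exists p.
apply: evH1 (small_evH R hp) => _ _; exists 1 => // e h.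
rewrite !(gtr0_norm (expR_gt0 _)) !mul1r ler_expR.
exact: le_trans (ler_norm _) h.
Qed.

(** Since |x| <= exp |x|; hence the coefficients of the systems define
    generalized constants for the exponential gauge. *)
Lemma RM_sub_exp B : RM B `<=` RM (exp_gauge B).
Proof.
move=> x Bx; have Bnx : RM B (fun e => `|x e|).
  by apply: RM_le Bx => e; rewrite normr_id.
apply: RM_le (RM_expR 1 Bnx) => e; rewrite mul1r (gtr0_norm (expR_gt0 _)).
by apply: le_trans (expR_ge1Dx _); rewrite lerDr.
Qed.

Lemma exp_gauge_dominated B x : RM (exp_gauge B) x ->
  exists2 p, gauge_pos B p & bigO_net x (fun e => expR (p e)).
Proof.
move=> [_ [H H0 [b Bb ->]] O].
have O' : bigO_net (fun e => H * b e) b.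
  by apply: (@bigO_le _ _ _ _ H) => e; rewrite normrM (gtr0_norm H0).
have [p pB hp] := gauge_dominates Bb O'; exists p => //.
apply: bigO_trans O _; apply: evH1 (small_evH R hp) => _ _; exists 1 => // e h.
rewrite !(gtr0_norm (expR_gt0 _)) mul1r ler_expR.
exact: le_trans (ler_norm _) h.
Qed.

(** A gauge contains a positive net tending to infinity, and a negligible net is
    bounded by a constant times the inverse of this net. *)
Lemma negl_small Z x (r : R) : negl_net Z x -> 0 < r ->
  for_small (fun e => `|x e| <= r).
Proof.
move=> nx r0; have [i Zi li] := is_gauge_infty (gaugeP Z).
have [p pZ hp] := gauge_dominates Zi (bigO_refl i).
have h : evH (fun H e => `|x e| <= H * `|(p e)^-1| /\ `|i e| <= p e).
  by apply: evH2 (nx p pZ) (small_evH R hp) => H _ H0 _; exists H.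
apply: (@evH_small R I (fun _ e => `|x e| <= r)) => //.
apply: evH_lim h li => H H0; exists (H / r); first exact: divr_gt0.
exists 1 => // e [hx ip] Hi.
have Hp : H / r < p e by exact: lt_le_trans ip.
have p0 : 0 < p e by apply: le_lt_trans Hp; rewrite divr_ge0// ltW.
apply: (le_trans hx); rewrite normfV (gtr0_norm p0) ler_pdivrMr// mulrC.
by rewrite -ler_pdivrMr// ltW.
Qed.

End gauge_growth.

(** * Linear systems of generalized functions *)

Section generalized_odes.
Variables (R : realType) (I : index_set).
Implicit Types (B : gauge R I) (C : colombeau R I).

Lemma gf_classD C (u v : EM_alg (mod_gauge C)) :
  gf_class (u + v) = gf_class u + gf_class v.
Proof. exact: (rmorphD (\pi_({ideal_quot (@negligible_pred R I C)})%qT)). Qed.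

Lemma gf_classM C (u v : EM_alg (mod_gauge C)) :
  gf_class (u * v) = gf_class u * gf_class v.
Proof. exact: (rmorphM (\pi_({ideal_quot (@negligible_pred R I C)})%qT)). Qed.

Lemma gf_class0 C : gf_class (0 : EM_alg (mod_gauge C)) = 0.
Proof. exact: (rmorph0 (\pi_({ideal_quot (@negligible_pred R I C)})%qT)). Qed.

Lemma gf_class_sum C (J : finType) (u : J -> EM_alg (mod_gauge C)) :
  gf_class (\sum_j u j) = \sum_j gf_class (u j).
Proof. by apply: big_morph; [exact: gf_classD|exact: gf_class0]. Qed.

Definition const_EM B C (h : RM B `<=` RM (mod_gauge C)) (x : RM B) :
  EM_alg (mod_gauge C) := mkEM (moderate_cst (h _ (set_valP x))).

(** Both directions pass between the equation in the quotient and the pointwise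
    equation of representatives through this form of the left-hand side. *)
Lemma ode_residualE B C (h : RM B `<=` RM (mod_gauge C)) d (A : 'M[RM B]_d)
    (x : 'cV[EM_alg (mod_gauge C)]_d) (i : 'I_d) (X := map_mx (@gf_class R I C) x) :
  (map_mx (@gf_derive R I C) X + map_mx (gf_const h) A *m X) i 0 =
  gf_class (EM_derive (x i 0) + \sum_j const_EM h (A i j) * x j 0).
Proof.
rewrite gf_classD gf_class_sum !mxE gf_deriveE; congr (_ + _).
by apply: eq_bigr => j _; rewrite gf_classM !mxE.
Qed.

Lemma EM_val_sum B (J : finType) (u : J -> EM_alg B) e t :
  EM_val (\sum_j u j) e t = \sum_j EM_val (u j) e t.
Proof. exact: (big_morph (fun v : EM_alg B => EM_val v e t)). Qed.

Lemma compact_bounded_around (K : set R) : compact K -> forall t0 : R,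
  exists2 r : R, 0 <= r & forall t, K t -> `|t - t0| <= r.
Proof.
move=> /compact_bounded[M [_ hM]] t0; exists (`|M| + 1 + `|t0|).
  by rewrite !addr_ge0.
move=> t Kt; apply: (le_trans (ler_normB _ _)); rewrite lerD2r.
by apply: hM => //; rewrite (le_lt_trans (ler_norm _))// ltrDl.
Qed.

Lemma RM_mx_sum_norm B m n (A : 'M[RM B]_(m, n)) :
  RM B (fun e => mx_sum_norm (\matrix_(i, j) val (A i j) e)).
Proof.
apply: RM_sum => i; apply: RM_sum => j.
by apply: RM_le (set_valP (A i j)) => e; rewrite mxE normr_id.
Qed.

Definition net_flow B d (t0 : R) (A : 'M[RM B]_d) (c : 'cV[RM B]_d) (i : 'I_d) :
    I -> R -> R :=
  fun e => linear_flow (\matrix_(k, l) val (A k l) e)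
    (\matrix_(k, l) val (c k l) e) t0 i.

(** On a compact set |t - t0| <= r, so the k-th derivative is bounded by
    |c| |A|^k exp(r |A|), where |A| and |c| are nets in RM B. *)
Lemma moderate_net_flow B d t0 (A : 'M[RM B]_d) c i :
  moderate_fun (exp_gauge B) (net_flow t0 A c i).
Proof.
split=> [e|K k cK]; first exact: smooth_linear_flow.
have [r r0 hr] := compact_bounded_around cK t0.
pose nA e := mx_sum_norm (\matrix_(k, l) val (A k l) e).
pose nc e := mx_sum_norm (\matrix_(k, l) val (c k l) e).
have hA : RM B nA := RM_mx_sum_norm A.
have hc : RM B nc := RM_mx_sum_norm c.
have hbound : RM (exp_gauge B) (fun e => nc e * nA e ^+ k * expR (r * nA e)).
  apply: RM_M (RM_expR r hA); apply: RM_M; first exact: RM_sub_exp.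
  by apply: RM_X; exact: RM_sub_exp.
apply: RM_le hbound => e; apply: net_le.
  by apply: sup_norm_kge0 => //; exact: smooth_linear_flow.
have nA0 : 0 <= nA e := mx_sum_norm_ge0 _.
have nc0 : 0 <= nc e := mx_sum_norm_ge0 _.
apply: sup_norm_le => [|t Kt]; first by rewrite !mulr_ge0 ?exprn_ge0 ?expR_ge0.
apply: (le_trans (derive1n_linear_flow_le _ _ _ _ _ _)).
apply: ler_wpM2l; first by rewrite !mulr_ge0 ?exprn_ge0.
by rewrite ler_expR mulrC ler_wpM2r// hr.
Qed.

Lemma linear_odes_solvable_exp B :
  linear_odes_solvable B (colombeau_diag (exp_gauge B)).
Proof.
exists (@RM_sub_exp R I B) => d d0 t0 A c.
pose C := colombeau_diag (exp_gauge B).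
pose x : 'cV[EM_alg (mod_gauge C)]_d := \col_i mkEM (moderate_net_flow t0 A c i).
exists x; split; last first.
  move=> i z pz; apply: (@bigO_le _ _ _ _ 0) => e.
  by rewrite mxE /= /net_flow linear_flow_init mxE subrr normr0 mul0r.
apply/matrixP => i j; rewrite !ord1 {j} ode_residualE [RHS]mxE -gf_class0.
congr gf_class; apply: val_inj; apply/funext => e; apply/funext => t.
rewrite -[LHS]/(EM_val (EM_derive (x i 0)) e t + EM_val (\sum_j _) e t).
rewrite EM_val_sum mxE /= /net_derive /net_flow derive1_linear_flow -big_split /=.
apply: big1 => j _; rewrite !mxE mulNr addrC; apply/eqP; rewrite subr_eq0.
exact/eqP.
Qed.

(** Solving x' - p x = 0, x(0) = 1 makes exp p eventually at most 2 x(1), hence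
    dominated by the moderateness bound of x on [0, 1]. *)
Lemma solvable_RM_exp B C : linear_odes_solvable B C ->
  RM (exp_gauge B) `<=` RM (mod_gauge C).
Proof.
move=> [h sol] x /exp_gauge_dominated[p [Bp pp] hx].
have Bnp : RM B (fun e => - p e).
  by apply: RM_le (RM_gset Bp) => e; rewrite normrN.
pose A : 'M[RM B]_1 := const_mx (SigSub (mem_set Bnp)).
pose c : 'cV[RM B]_1 := const_mx (SigSub (mem_set (RM_cst B 1))).
have [X [eqX initX]] := sol 1%N isT 0 A c.
pose u := X 0 0.
have [su mu] := EM_moderate u.
have r0 : 0 < 4^-1 :> R by [].
have cI : compact `[0 : R, 1] by exact: segment_compact.
have hinit : for_small (fun e => `|EM_val u e 0 - 1| <= 4^-1).
  by have := negl_small (initX 0) r0; rewrite mxE.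
have hres : for_small (fun e => forall t, t \in `[0, 1]%R ->
    `|derive1 (EM_val u e) t - p e * EM_val u e t| <= 4^-1).
  have := congr1 (fun M : 'cV[gf C]_1 => M 0 0) eqX.
  rewrite ode_residualE big_ord1 [RHS]mxE -gf_class0.
  move/gf_classP; set w := (X in negligible_fun _ X) => -[sw nw].
  have wE e t : w e t = derive1 (EM_val u e) t - p e * EM_val u e t.
    rewrite -[LHS]/(derive1 (EM_val u e) t +
      EM_val (const_EM h (A 0 0)) e t * EM_val u e t - 0).
    by rewrite subr0 mxE /= mulNr.
  apply: for_small2 (negl_small (nw _ 0%N cI) r0) pp => e he _ t t01; rewrite -wE.
  apply: le_trans (le_sup_norm cI (smooth_continuous (sw e)) _) _; first exact: t01.
  exact: le_trans (ler_norm _) he.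
have hp : for_small (fun e => `|expR (p e)| <=
    2 * `|sup_norm `[0 : R, 1] (derive1n 0 (EM_val u e))|).
  have pinit : for_small (fun e => 0 < p e /\ `|EM_val u e 0 - 1| <= 4^-1).
    by apply: for_small2 pp hinit.
  apply: for_small2 pinit hres => e [pe ie] re.
  rewrite (gtr0_norm (expR_gt0 _)).
  apply: le_trans (exp_le_perturbed_solution (su e) (ltW pe) re ie) _.
  rewrite ler_pM2l//; apply: le_trans (ler_norm _) _.
  apply: le_trans (le_sup_norm cI (smooth_continuous (su e)) _) (ler_norm _).
  by rewrite /= in_itv/= ler01 lexx.
have [b Cb Ob] := RM_small_le hp (mu _ 0%N cI).
by exists b => //; exact: bigO_trans hx Ob.
Qed.

End generalized_odes.

Theorem theorem56 (R : realType) (I : index_set) (B : gauge R I) :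
  linear_odes_solvable B (colombeau_diag (exp_gauge B)) /\
  (forall C : colombeau R I,
     linear_odes_solvable B C -> colombeau_le (colombeau_diag (exp_gauge B)) C).
Proof.
split=> [|C solC]; first exact: linear_odes_solvable_exp.
have expC := solvable_RM_exp solC.
split=> //; first exact: gauge_incl.
by apply: subset_trans expC _; exact: gauge_incl.
Qed.
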